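(* Let $\beta>1$ be an integer and let $(X_i)_{i=0}^\infty$ be the Rényi map process, i.e. $X_0\sim U(0,1)$ and $X_{i+1}=f(X_i)$ with $f:[0,1)\to[0,1)$, $f(x)=\beta x\pmod 1$. Then the condition $D'(u_n)$ does not hold for any sequence $(u_n)_{n=1}^\infty$ that satisfies \[ \lim_{n\to\infty}n\,\mathbb{P}(X_0>u_n)=\lim_{n\to\infty}n(1-u_n)=\lambda>0. \]
   Context: The condition $D'(u_n)$ is said to hold for the sequences $(X_i)_{i=0}^\infty$ and $(u_n)_{n=1}^\infty$ if \[ \lim_{k\to\infty}\bigg(\limsup_{n\to\infty}\, n\sum_{j=1}^{\lfloor n/k\rfloor}\mathbb{P}(X_0>u_n,\,X_j>u_n)\bigg)=0. \] Here $U(0,1)$ denotes the uniform distribution on the unit interval. *)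

(* Defs.v *)
From mathcomp Require Import all_boot all_order all_algebra.
From mathcomp Require Import all_classical all_reals all_analysis.
Set Implicit Arguments.
Unset Strict Implicit.
Unset Printing Implicit Defensive.
Import Order.TTheory GRing.Theory Num.Theory.
Import numFieldNormedType.Exports.
Local Open Scope classical_set_scope.
Local Open Scope ring_scope.

(* The formula for beta * x mod 1 is used on the whole of R: a variable with
   the uniform law lies in [0, 1) only almost surely. *)
Definition renyi_map (R : realType) (beta : nat) (x : R) : R :=
  beta%:R * x - (Num.floor (beta%:R * x))%:~R.

(* Equality in law is required on measurable sets only, because measures are
   total functions with unspecified values on the other sets. *)
Definition renyi_process (d : measure_display) (T : measurableType d)
    (R : realType) (P : probability T R) (beta : nat)
    (X : nat -> {RV P >-> R}) : Prop :=
  (forall A : set R, measurable A ->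
     distribution P (X 0%N) A = uniform_prob (@ltr01 R) A) /\
  (forall (i : nat) (w : T), X i.+1 w = renyi_map beta (X i w)).

(* The upper limit is taken in the extended reals, as it may be infinite.
   The terms at n = 0 and k = 0 do not affect the limits. *)
Definition condition_D' (d : measure_display) (T : measurableType d)
    (R : realType) (P : probability T R) (X : nat -> {RV P >-> R})
    (u : nat -> R) : Prop :=
  (limn_esup (fun n : nat =>
     n%:R%:E * \sum_(1 <= j < (n %/ k).+1)
       P [set w | (u n < X 0%N w)%R /\ (u n < X j w)%R])%E) @[k --> \oo] --> 0%E.

(* Main.v *)
Require Import Defs.
From mathcomp Require Import all_boot all_order all_algebra.
From mathcomp Require Import all_classical all_reals all_analysis.
From mathcomp Require Import ring lra.
Import Order.TTheory GRing.Theory Num.Theory.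
Import numFieldNormedType.Exports.
Local Open Scope classical_set_scope.
Local Open Scope ring_scope.

(** On the last branch of the map, x |-> 1 - beta * (1 - x), the point 1 is
    fixed and the distance to 1 is multiplied by beta. So an exceedance of a
    high level tends to be followed by another one: for 0 <= u <= 1, the event
    1 - (1 - u) / beta < X_0 < 1 forces both X_0 > u and X_1 > u, and it has
    probability (1 - u) / beta under the uniform law (joint_exceedance_ge).
    The term j = 1 alone, which belongs to the sum as soon as 1 <= k <= n, thus
    contributes at least n * (1 - u_n) / beta, which tends to lambda / beta > 0.
    This bounds the upper limit in n away from 0 uniformly in k, and so its
    limit in k cannot be 0. *)

Lemma limn_esup_ge_near (R : realType) (a : nat -> \bar R) (c : \bar R) :
  (\forall n \near \oo, (c <= a n)%E) -> (c <= limn_esup a)%E.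
Proof.
move=> hc; apply: le_ereal_inf_tmp => _ [V hV <-].
have [n [Vn cn]] : exists n, V n /\ (c <= a n)%E.
  by apply: (@filter_ex _ \oo); apply: filterI.
by apply: le_trans cn _; apply: ereal_sup_ubound; exists n.
Qed.

Lemma uniform_prob01_itvoo (R : realType) (a b : R) :
  0 <= a -> a <= b -> b <= 1 ->
  uniform_prob (@ltr01 R) `]a, b[ = (b - a)%:E.
Proof.
move=> a0 ab b1; rewrite /uniform_prob.
rewrite (eq_integral (fun=> 1%E)) => [|x]; last first.
  rewrite inE/= in_itv/= => /andP[ax xb]; rewrite /uniform_pdf.
  by rewrite (le_trans a0 (ltW ax)) (le_trans (ltW xb) b1) subr0 invr1.
rewrite integral_cst//= mul1e lebesgue_measure_itv/= lte_fin.
by case: ltgtP ab => // -> _; rewrite subrr.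
Qed.

(** For x within 1 / beta of 1, the product beta * x has integer part
    beta - 1: this is the last branch of the map. *)
Lemma renyi_map_last_branch (R : realType) (beta : nat) (x : R) :
  (0 < beta)%N -> 1 - beta%:R^-1 <= x < 1 ->
  renyi_map beta x = 1 - beta%:R * (1 - x).
Proof.
move=> b0 /andP[lx x1]; rewrite /renyi_map.
have bR : 0 < beta%:R :> R by rewrite ltr0n.
rewrite (@floor_def _ _ (beta%:Z - 1)); last first.
  rewrite subrK rmorphB/= -[beta%:~R]/(beta%:R) gtr_pMr// x1 andbT.
  by move: lx; rewrite -(ler_pM2l bR) mulrBr mulr1 divff// gt_eqF.
rewrite rmorphB/= -[beta%:~R]/(beta%:R); ring.
Qed.

Section JointExceedance.
Context {d : measure_display} {T : measurableType d} {R : realType}.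
Context {P : probability T R} {X : nat -> {RV P >-> R}}.

Lemma measurable_joint_exceedance (j : nat) (u : R) :
  measurable [set w | u < X 0%N w /\ u < X j w].
Proof.
have m i : measurable [set w | u < X i w].
  have -> : [set w | u < X i w] = X i @^-1` `]u, +oo[.
    by apply/seteqP; split=> w /=; rewrite in_itv/= andbT.
  exact: measurable_funPTI.
apply: (measurableI _ _ (m 0%N) (m j)).
Qed.

(** The bounds on u keep the interval from 1 - (1 - u) / beta to 1 inside the
    last branch, where X_1 is an explicit affine function of X_0. *)
Lemma joint_exceedance_ge (beta : nat) (u : R) :
  (0 < beta)%N -> renyi_process beta X -> 0 <= u <= 1 ->
  (((1 - u) / beta%:R)%:E <= P [set w | (u < X 0%N w)%R /\ (u < X 1%N w)%R])%E.
Proof.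
move=> b0 [X0 XS] /andP[u0 u1].
have bR : 0 < beta%:R :> R by rewrite ltr0n.
have bV1 : beta%:R^-1 <= 1 :> R by rewrite invf_le1// ler1n.
have q0 : 0 <= (1 - u) / beta%:R by rewrite divr_ge0 ?subr_ge0// ltW.
have qu : (1 - u) / beta%:R <= 1 - u by rewrite ler_piMr ?subr_ge0.
have qb : (1 - u) / beta%:R <= beta%:R^-1.
  by rewrite ler_piMl ?invr_ge0 ?ler0n// lerBlDr lerDl.
have := X0 _ (measurable_itv `]1 - (1 - u) / beta%:R, 1[).
rewrite uniform_prob01_itvoo//; [|lra..].
rewrite subKr => <-.
rewrite [leLHS]/(P _); apply: le_measure; rewrite ?inE.
- exact: measurable_funPTI.
- exact: measurable_joint_exceedance.
move=> w /=; rewrite in_itv/= => /andP[vx x1]; split; first lra.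
rewrite XS renyi_map_last_branch//; last by apply/andP; split=> //; lra.
suff : beta%:R * (1 - X 0%N w) < 1 - u by lra.
by rewrite mulrC -ltr_pdivlMr//; lra.
Qed.

End JointExceedance.

Theorem mainTheorem5 (d : measure_display) (T : measurableType d)
  (R : realType) (P : probability T R) (beta : nat) (hbeta : (1 < beta)%N)
  (X : nat -> {RV P >-> R}) (hX : renyi_process beta X)
  (u : nat -> R) (lambda : R) (hlambda : 0 < lambda)
  (hP : (n%:R%:E * P [set w | (u n < X 0%N w)%R])%E @[n --> \oo] --> lambda%:E)
  (hu : n%:R * (1 - u n) @[n --> \oo] --> lambda) :
  ~ condition_D' X u.
Proof.
have b0 : (0 < beta)%N by apply: ltnW.
have bR : 0 < beta%:R :> R by rewrite ltr0n.
(* Half of the limit lambda / beta: n * (1 - u n) need only be eventually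
   close to lambda. *)
pose c := lambda / 2 / beta%:R.
have c0 : 0 < c by rewrite !divr_gt0.
have lb k : (0 < k)%N -> (c%:E <= limn_esup (fun n : nat =>
    n%:R%:E * \sum_(1 <= j < (n %/ k).+1)
      P [set w | (u n < X 0%N w)%R /\ (u n < X j w)%R])%E)%E.
  move=> k0; apply: limn_esup_ge_near.
  have lower : \forall n \near \oo, lambda / 2 < n%:R * (1 - u n).
    by apply: (cvgr_gt lambda) => //; lra.
  have upper : \forall n \near \oo, n%:R * (1 - u n) < 2 * lambda.
    by apply: (cvgr_lt lambda) => //; lra.
  near=> n.
  have hl : lambda / 2 < n%:R * (1 - u n) by near: n.
  have hr : n%:R * (1 - u n) < 2 * lambda by near: n.
  (* With n (1 - u n) < 2 lambda, this makes u n nonnegative. *)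
  have nl : 2 * lambda <= n%:R by near: n; exact: nbhs_infty_ger.
  have kn : (k <= n)%N by near: n; exact: nbhs_infty_ge.
  have n0 : 0 < n%:R :> R by rewrite ltr0n (leq_trans k0).
  have u1 : u n <= 1.
    by rewrite -subr_ge0 -(pmulr_rge0 _ n0); apply: ltW; lra.
  have u0 : 0 <= u n.
    suff : 1 - u n <= 1 by lra.
    by rewrite -(ler_pM2l n0) mulr1; lra.
  rewrite big_ltn; last by rewrite ltnS divn_gt0.
  apply: (@le_trans _ _ (n%:R%:E * ((1 - u n) / beta%:R)%:E)%E).
    by rewrite -EFinM lee_fin mulrA ler_pM2r ?invr_gt0// ltW.
  rewrite lee_pmul2l ?lte_fin//.
  apply: le_trans (joint_exceedance_ge _ _ b0 hX _) _; first by rewrite u0.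
  by rewrite leeDl// sume_ge0.
move=> hD; have : (c%:E <= 0)%E.
  apply: (cvge_ge _ hD); near=> k; apply: lb; near: k; exact: nbhs_infty_gt.
by rewrite lee_fin leNgt c0.
Unshelve. all: by end_near.
Qed.
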